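(* Let $p:\mathcal E\to\mathcal B$ be a fibration whose fibers are Boolean algebras and whose reindexing functors are Boolean algebra homomorphisms. Then there exist a functor $\Phi:\mathcal B\to\mathbf{Stone}$ and a functor $\mathcal E\to\mathbf{Clopen}$ forming a pullback square of categories with $p$ and the forgetful functor $\mathbf{Clopen}\to\mathbf{Stone}$; that is, $p$ is obtained as the change of base of $\mathbf{Clopen}\to\mathbf{Stone}$ along $\Phi$.
   Context: $\mathbf{Stone}$ is the category of Stone spaces (compact Hausdorff totally disconnected spaces) and continuous maps. $\mathbf{Clopen}$ is the category whose objects are pairs $(X,S)$ with $X$ a Stone space and $S\subseteq X$ clopen (both open and closed), and whose morphisms $(X,S)\to(Y,T)$ are continuous maps $f:X\to Y$ with $f(S)\subseteq T$; the forgetful functor $(X,S)\mapsto X$ is a fibration $\mathbf{Clopen}\to\mathbf{Stone}$. A fibration $p:\mathcal E\to\mathcal B$ has cartesian liftings of all base morphisms; its fiber over $X$ is the subcategory of objects over $X$ and morphisms over $\mathrm{id}_X$, and reindexing along $f$ is the induced functor $f^*$ between fibers. *)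

(* Defs.v *)
From mathcomp Require Import all_boot all_order.
From mathcomp Require Import boolp classical_sets topology.

Set Implicit Arguments.
Unset Strict Implicit.
Unset Printing Implicit Defensive.

Declare Scope cat_scope.
Delimit Scope cat_scope with cat.
Local Open Scope classical_set_scope.
Local Open Scope cat_scope.

Record category := Category {
  obj :> Type;
  hom : obj -> obj -> Type;
  idc : forall x, hom x x;
  compc : forall x y z, hom y z -> hom x y -> hom x z;
  id_comp : forall x y (f : hom x y), compc (idc y) f = f;
  comp_id : forall x y (f : hom x y), compc f (idc x) = f;
  comp_assoc : forall w x y z (h : hom y z) (g : hom x y) (f : hom w x),
    compc h (compc g f) = compc (compc h g) f }.

Arguments hom {c} x y.
Arguments idc {c} x.
Arguments compc {c x y z} g f.

Notation "g \c f" := (compc g f) (at level 50, left associativity) : cat_scope.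

Record functor (C D : category) := Functor {
  fobj :> C -> D;
  fhom : forall x y, hom x y -> hom (fobj x) (fobj y);
  fhom1 : forall x, fhom (idc x) = idc (fobj x);
  fhomM : forall x y z (g : hom y z) (f : hom x y),
    fhom (g \c f) = fhom g \c fhom f }.

Arguments fhom {C D} F {x y} f : rename.

(* The laws of a functor are propositions, so by proof irrelevance Leibniz
   equality of functors is strict equality on objects and on arrows. *)

Definition functor_id (C : category) : functor C C :=
  @Functor C C (fun x => x) (fun _ _ f => f)
    (fun _ => erefl) (fun _ _ _ _ _ => erefl).

Section FunctorComp.
Variables (C D D' : category) (G : functor D D') (F : functor C D).

Let fcomp1 x : fhom G (fhom F (idc x)) = idc (G (F x)).
Proof. by rewrite !fhom1. Qed.

Let fcompM x y z (g : hom y z) (f : hom x y) :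
  fhom G (fhom F (g \c f)) = fhom G (fhom F g) \c fhom G (fhom F f).
Proof. by rewrite !fhomM. Qed.

Definition functor_comp : functor C D' := Functor fcomp1 fcompM.

End FunctorComp.

Record cat_iso (C D : category) := CatIso {
  iso_to : functor C D;
  iso_from : functor D C;
  iso_toK : functor_comp iso_from iso_to = functor_id C;
  iso_fromK : functor_comp iso_to iso_from = functor_id D }.

(*      Q
    P --> A'
  P |     | U     is a pullback in the category of categories.
    v     v
    A --> C
       F                                                                 *)
Definition is_pullback (P A A' C : category)
    (p : functor P A) (q : functor P A') (F : functor A C) (U : functor A' C) :=
  functor_comp F p = functor_comp U q /\
  forall (D : category) (s : functor D A) (t : functor D A'),
    functor_comp F s = functor_comp U t ->
    exists! h : functor D P, functor_comp p h = s /\ functor_comp q h = t.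

Section Fibrations.
Variables (E B : category) (p : functor E B).

(* [lies_over u f] says "p u = f", for [f : hom a b] between objects that are
   only propositionally equal to the images of the endpoints of [u]. *)
Inductive lies_over (x y : E) (u : hom x y) : forall a b : B, hom a b -> Prop :=
  LiesOver : lies_over u (fhom p u).

Definition cartesian (x y : E) (u : hom x y) :=
  forall (z : E) (v : hom z y) (w : hom (p z) (p x)),
    fhom p v = fhom p u \c w ->
    exists! h : hom z x, fhom p h = w /\ u \c h = v.

Definition fibration :=
  forall (y : E) (a : B) (f : hom a (p y)),
    exists (x : E) (u : hom x y), lies_over u f /\ cartesian u.

Lemma lies_overP (x y : E) (u : hom x y) (a b : B) (f : hom a b) :
  lies_over u f ->
  exists (ea : p x = a) (eb : p y = b),
    ecast b' (hom a b') eb (ecast a' (hom a' (p y)) ea (fhom p u)) = f.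
Proof. by case; exists erefl, erefl. Qed.

Lemma lies_overE (x y : E) (u : hom x y) (f : hom (p x) (p y)) :
  lies_over u f -> fhom p u = f.
Proof.
by move=> /lies_overP[ea [eb]]; rewrite (Prop_irrelevance ea erefl)
  (Prop_irrelevance eb erefl).
Qed.

Lemma lies_over_id (x : E) (b : B) : p x = b -> lies_over (idc x) (idc b).
Proof. by case: b /; rewrite -fhom1. Qed.

Lemma lies_over_comp (x y z : E) (v : hom y z) (u : hom x y)
    (a b c : B) (g : hom b c) (f : hom a b) :
  lies_over v g -> lies_over u f -> lies_over (v \c u) (g \c f).
Proof.
move=> vg uf; have [ea [eb _]] := lies_overP uf.
have [_ [ec _]] := lies_overP vg; subst a b c.
by rewrite -(lies_overE vg) -(lies_overE uf) -fhomM.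
Qed.

Lemma cartesian_factor (x y z : E) (u : hom x y) (v : hom z y)
    (a b c : B) (f : hom a b) (w : hom c a) :
  lies_over u f -> cartesian u -> lies_over v (f \c w) ->
  exists! h : hom z x, lies_over h w /\ u \c h = v.
Proof.
move=> uf cu vfw; have [ea [eb _]] := lies_overP uf.
have [ec _] := lies_overP vfw; subst a b c.
have [|h [[hw uh] hU]] := cu z v w; first by rewrite (lies_overE vfw) (lies_overE uf).
exists h; split=> [|h' [h'w uh']]; first by split=> //; rewrite -hw.
by apply: hU; split=> //; apply: lies_overE.
Qed.

Section Fiber.
Variable b : B.

Definition fiber_obj := {x : E | p x = b}.

Definition fiber_hom (x y : fiber_obj) :=
  {u : hom (sval x) (sval y) | lies_over u (idc b)}.

Definition fiber_id (x : fiber_obj) : fiber_hom x x :=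
  exist _ (idc (sval x)) (lies_over_id (svalP x)).

Lemma fiber_comp_subproof (x y z : fiber_obj)
    (v : fiber_hom y z) (u : fiber_hom x y) :
  lies_over (sval v \c sval u) (idc b).
Proof.
have := lies_over_comp (svalP v) (svalP u); by rewrite comp_id.
Qed.

Definition fiber_comp (x y z : fiber_obj)
    (v : fiber_hom y z) (u : fiber_hom x y) : fiber_hom x z :=
  exist _ (sval v \c sval u) (fiber_comp_subproof v u).

Lemma fiber_hom_inj (x y : fiber_obj) (u v : fiber_hom x y) :
  sval u = sval v -> u = v.
Proof. by case: u v => [u ?] [v ?] /= uv; apply: eq_exist. Qed.

Lemma fiber_id_comp (x y : fiber_obj) (u : fiber_hom x y) :
  fiber_comp (fiber_id y) u = u.
Proof. by apply: fiber_hom_inj; apply: id_comp. Qed.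

Lemma fiber_comp_id (x y : fiber_obj) (u : fiber_hom x y) :
  fiber_comp u (fiber_id x) = u.
Proof. by apply: fiber_hom_inj; apply: comp_id. Qed.

Lemma fiber_compA (w x y z : fiber_obj)
    (t : fiber_hom y z) (v : fiber_hom x y) (u : fiber_hom w x) :
  fiber_comp t (fiber_comp v u) = fiber_comp (fiber_comp t v) u.
Proof. by apply: fiber_hom_inj; apply: comp_assoc. Qed.

Definition fiber : category :=
  Category fiber_id_comp fiber_comp_id fiber_compA.

End Fiber.

(* The reindexing functor f^* : fiber b -> fiber a, for the cartesian liftings
   selected by a choice operator. *)
Section Reindexing.
Hypothesis fib_p : fibration.
Variables (a b : B) (f : hom a b).

Lemma fiber_lift (y : fiber b) :
  exists (x : fiber a) (u : hom (sval x) (sval y)), lies_over u f /\ cartesian u.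
Proof.
case: y f => y eb g; case: b / eb g => g /=.
have [x [u [ug cu]]] := fib_p g; have [ea _] := lies_overP ug.
by exists (exist _ x ea), u.
Qed.

Definition reindex_obj (y : fiber b) : fiber a := sval (cid (fiber_lift y)).

Definition reindex_lift (y : fiber b) : hom (sval (reindex_obj y)) (sval y) :=
  sval (cid (svalP (cid (fiber_lift y)))).

Lemma reindex_lift_over (y : fiber b) : lies_over (reindex_lift y) f.
Proof. by have [] := svalP (cid (svalP (cid (fiber_lift y)))). Qed.

Lemma reindex_lift_cartesian (y : fiber b) : cartesian (reindex_lift y).
Proof. by have [] := svalP (cid (svalP (cid (fiber_lift y)))). Qed.

Lemma reindex_factor (y z : fiber b) (v : hom y z) :
  exists! h : hom (sval (reindex_obj y)) (sval (reindex_obj z)),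
    lies_over h (idc a) /\ reindex_lift z \c h = sval v \c reindex_lift y.
Proof.
apply: (cartesian_factor (reindex_lift_over z) (@reindex_lift_cartesian z)).
rewrite comp_id -[f]id_comp; apply: lies_over_comp; first exact: svalP v.
exact: reindex_lift_over.
Qed.

Lemma reindex_hom_exists (y z : fiber b) (v : hom y z) :
  exists h : hom (reindex_obj y) (reindex_obj z),
    reindex_lift z \c sval h = sval v \c reindex_lift y.
Proof.
by have [h [[hO hE] _]] := reindex_factor v; exists (exist _ h hO).
Qed.

Definition reindex_hom (y z : fiber b) (v : hom y z) :
  hom (reindex_obj y) (reindex_obj z) := sval (cid (reindex_hom_exists v)).

Lemma reindex_homE (y z : fiber b) (v : hom y z) :
  reindex_lift z \c sval (reindex_hom v) = sval v \c reindex_lift y.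
Proof. exact: svalP (cid (reindex_hom_exists v)). Qed.

Lemma reindex_hom_unique (y z : fiber b) (v : hom y z)
    (h : hom (reindex_obj y) (reindex_obj z)) :
  reindex_lift z \c sval h = sval v \c reindex_lift y -> reindex_hom v = h.
Proof.
move=> hE; apply: fiber_hom_inj; have [k [_ kU]] := reindex_factor v.
rewrite -(kU (sval (reindex_hom v))) ?(kU (sval h)) //; split=> //.
- exact: svalP h.
- exact: svalP (reindex_hom v).
- exact: reindex_homE.
Qed.

Lemma reindex_hom1 (y : fiber b) : reindex_hom (idc y) = idc (reindex_obj y).
Proof. by apply: reindex_hom_unique; rewrite /= comp_id id_comp. Qed.

Lemma reindex_homM (x y z : fiber b) (v : hom y z) (u : hom x y) :
  reindex_hom (v \c u) = reindex_hom v \c reindex_hom u.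
Proof.
by apply: reindex_hom_unique; rewrite /= comp_assoc reindex_homE -comp_assoc reindex_homE comp_assoc.
Qed.

Definition reindexing : functor (fiber b) (fiber a) :=
  Functor reindex_hom1 reindex_homM.

End Reindexing.

End Fibrations.

Arguments reindexing {E B p} fib_p {a b} f.

Section BooleanAlgebras.
Local Open Scope order_scope.
Import Order.Theory.

(* A category may be large (e.g. [Stone] below), a lattice type is small: an
   isomorphism of a category with some [poset_cat A] also makes it small. *)
Definition poset_cat (d : Order.disp_t) (A : porderType d) : category.
Proof.
refine (@Category A (fun x y => x <= y) (fun x => lexx x)
          (fun x y z yz xy => le_trans xy yz) _ _ _).
all: by move=> *; apply: Prop_irrelevance.
Defined.

Definition boolean_hom (d d' : Order.disp_t) (A : ctbDistrLatticeType d)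
    (A' : ctbDistrLatticeType d') (h : A -> A') :=
  [/\ h \bot = \bot, h \top = \top, {morph h : x y / x `&` y},
      {morph h : x y / x `|` y} & {morph h : x / ~` x}].

End BooleanAlgebras.

(* A [topologicalType] also carries a choice operator on its points, invisible
   to continuous maps; nonemptiness is not required, so the empty space is
   allowed (it is dual to the one-element Boolean algebra). *)
Record stone_space := StoneSpace {
  stone_carrier :> topologicalType;
  stone_compact : compact [set: stone_carrier];
  stone_hausdorff : hausdorff_space stone_carrier;
  stone_td : totally_disconnected [set: stone_carrier] }.

Definition Stone : category.
Proof.
refine (@Category stone_space (fun X Y => continuousType X Y)
          (fun X => idfun : continuousType X X)
          (fun X Y Z g f => (g \o f)%FUN : continuousType X Z) _ _ _).
all: by move=> *; apply/continuousEP.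
Defined.

Record clopen_pair := ClopenPair {
  clopen_space :> stone_space;
  clopen_set : set clopen_space;
  clopen_setP : clopen clopen_set }.

Arguments clopen_set : clear implicits.

Definition clopen_hom (X Y : clopen_pair) :=
  {f : continuousType X Y | f @` clopen_set X `<=` clopen_set Y}.

Lemma clopen_hom_inj (X Y : clopen_pair) (f g : clopen_hom X Y) :
  sval f =1 sval g -> f = g.
Proof. by case: f g => [f ?] [g ?] /= fg; apply: eq_exist; apply/continuousEP. Qed.

Lemma clopen_id_subproof (X : clopen_pair) :
  @idfun X @` clopen_set X `<=` clopen_set X.
Proof. by rewrite image_id. Qed.

Lemma clopen_comp_subproof (X Y Z : clopen_pair)
    (g : clopen_hom Y Z) (f : clopen_hom X Y) :
  (sval g \o sval f) @` clopen_set X `<=` clopen_set Z.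
Proof.
move=> _ [x Sx <-]; apply: (svalP g); exists (sval f x) => //.
by apply: (svalP f); exists x.
Qed.

Definition Clopen : category.
Proof.
refine (@Category clopen_pair clopen_hom
  (fun X => exist _ (idc (X : Stone)) (@clopen_id_subproof X))
  (fun X Y Z g f => exist _ (@compc Stone X Y Z (sval g) (sval f))
                            (@clopen_comp_subproof X Y Z g f)) _ _ _).
all: by move=> *; apply: clopen_hom_inj.
Defined.

Definition Clopen_forget : functor Clopen Stone :=
  @Functor Clopen Stone clopen_space (fun _ _ f => sval f)
    (fun _ => erefl) (fun _ _ _ _ _ => erefl).

(* Main.v *)
(* The functor Phi sends [b] to the Stone space of the Boolean algebra [A b].
   The fibers are posets, so an object over [b] is the same as an element of
   [A b], hence, by Stone duality, as a clopen of [Phi b]; and an arrow over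
   [f : a -> b] from [x] to [y] exists iff [x <= f^* y], is then unique, and
   exists exactly when [Phi f] maps the clopen of [x] into the clopen of [y].
   Thus objects and arrows of [E] correspond bijectively to compatible pairs of
   objects and arrows of [B] and [Clopen]. *)

Require Import Defs.
From mathcomp Require Import all_boot all_order.
From HB Require Import structures.
From mathcomp Require Import boolp classical_sets topology.

Set Implicit Arguments.
Unset Strict Implicit.
Unset Printing Implicit Defensive.

Local Open Scope classical_set_scope.
Local Open Scope cat_scope.

(** * Stone duality: the space of points of a Boolean algebra *)

Section StoneDuality.
Local Open Scope order_scope.
Import Order.Theory.

Lemma boolean_hom_of_meet_compl (d d' : Order.disp_t)
    (A : ctbDistrLatticeType d) (A' : ctbDistrLatticeType d') (h : A -> A') :
  {morph h : x y / x `&` y} -> {morph h : x / ~` x} -> boolean_hom h.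
Proof.
move=> hI hC; have h0 : h \bot = \bot by rewrite -(meetxC \bot) hI hC meetxC.
split=> // [|x y]; first by rewrite -!compl0 hC h0.
by rewrite -[x `|` y]complK complU hC hI !hC complI !complK.
Qed.

Lemma boolean_hom_comp (d1 d2 d3 : Order.disp_t) (A1 : ctbDistrLatticeType d1)
    (A2 : ctbDistrLatticeType d2) (A3 : ctbDistrLatticeType d3)
    (g : A2 -> A3) (f : A1 -> A2) :
  boolean_hom g -> boolean_hom f -> boolean_hom (g \o f).
Proof.
move=> [_ _ gI _ gC] [_ _ fI _ fC]; apply: boolean_hom_of_meet_compl => [x y|x] /=.
  by rewrite fI gI.
by rewrite fC gC.
Qed.

Section Points.
Variables (d : Order.disp_t) (A : ctbDistrLatticeType d).

Lemma boolean_hom_le (h : A -> bool) x y : boolean_hom h -> x <= y -> h x -> h y.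
Proof. by case=> _ _ hI _ _ /meet_idPl <-; rewrite hI => /andP[]. Qed.

(* Below a nonzero [z], the predicate [x <= -] already preserves meets, and it
   preserves the complement of [a] as soon as [x] decides [a], which holds on a
   dense set of [x].  An ultrafilter extending the filter of sets that are dense
   below [c] thus turns these predicates into a point. *)
Lemma exists_point (c : A) : c != \bot ->
  exists2 h : A -> bool, boolean_hom h & h c.
Proof.
move=> c0; pose F : set_system A := [set P | forall y, y != \bot -> y <= c ->
  exists z, [/\ z != \bot, z <= y & forall w, w != \bot -> w <= z -> P w]].
have FF : ProperFilter F.
  apply: Build_ProperFilter_ex => [P /(_ c c0 (lexx c))[z [z0 _ zP]]|].
    by exists z; apply: zP.
  split=> [y y0 _|P Q FP FQ y y0 yc|P Q PQ FP y y0 yc].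
  - by exists y.
  - have [z [z0 zy zP]] := FP y y0 yc.
    have [t [t0 tz tQ]] := FQ z z0 (le_trans zy yc).
    exists t; split=> // [|w w0 wt]; first exact: le_trans zy.
    by split; [apply: zP => //; apply: le_trans tz | apply: tQ].
  - by have [z [z0 zy zP]] := FP y y0 yc; exists z; split=> // w w0 wz; apply/PQ/zP.
have [G [GU FG]] := ultraFilterLemma FF.
have G_decide a : G [set x | x <= a] \/ G [set x | x <= ~` a].
  have : G [set x | (x <= a) || (x <= ~` a)].
    apply: FG => y y0 _; case: (eqVneq (y `&` a) \bot) => [ya|ya].
      exists y; split=> // w _ wy /=; apply/orP; right.
      by apply: le_trans wy _; rewrite -disj_leC ya.
    exists (y `&` a); split=> // [|w _ wy /=]; first exact: leIl.
    by apply/orP; left; apply: le_trans wy (leIr _ _).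
  have [Ga _|Ga Go] := in_ultra_setVsetC [set x | x <= a] GU; first by left.
  by right; apply: filterS (filterI Ga Go) => x /= [xa /orP[]].
have G0 : ~ G [set x | x <= \bot].
  have : G [set x | x != \bot] by apply: FG => y y0 _; exists y.
  move=> G1 G2; have [x [/= /negP x0]] := filter_ex (filterI G1 G2).
  by rewrite lex0.
exists (fun a => `[< G [set x | x <= a] >]); last first.
  apply/asboolP; apply: FG => y y0 yc; exists y; split=> // w _ wy /=.
  exact: le_trans yc.
apply: boolean_hom_of_meet_compl => [a b|a] /=.
  apply/asboolP/andP => [Gab|[/asboolP Ga /asboolP Gb]].
    by split; apply/asboolP; apply: filterS Gab => x /=; rewrite lexI => /andP[].
  by apply: filterS (filterI Ga Gb) => x /= [xa xb]; rewrite lexI xa.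
apply/asboolP/idP => [Ga'|/asboolPn]; last by case: (G_decide a).
apply/asboolPn => Ga; apply: G0; apply: filterS (filterI Ga Ga') => x /= [xa xa'].
by rewrite -(meetxC a) lexI xa.
Qed.

(** If [a <= b] fails, the meet of [a] with the complement of [b] is nonzero, and a point true there
    is true at [a] and false at [b]. *)
Lemma point_separation (a b : A) :
  (forall h : A -> bool, boolean_hom h -> h a -> h b) -> a <= b.
Proof.
move=> hab; rewrite -[b]complK -disj_leC; apply/negPn/negP => /exists_point[h hh].
by case: (hh) => _ _ hI _ hC; rewrite hI hC => /andP[/hab-> //].
Qed.

(** These are the characteristic functions of the ultrafilters of [A]. *)
Definition spectrum := {h : A -> bool | boolean_hom h}.

Lemma spectrum_ext (h k : spectrum) : sval h =1 sval k -> h = k.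
Proof. by case: h k => [h ?] [k ?] /= /funext hk; apply: eq_exist. Qed.

HB.instance Definition _ := gen_eqMixin spectrum.
HB.instance Definition _ := gen_choiceMixin spectrum.

Definition basic_set (a : A) : set spectrum := [set h : spectrum | sval h a].

(** The basic sets are closed under binary intersection ([basic_setI]), so they serve as a base and
    not merely as a subbase. *)
Definition spectrum_open : set_system spectrum :=
  [set O | forall h, O h -> exists2 a, basic_set a h & basic_set a `<=` O].

Lemma spectrum_openT : spectrum_open setT.
Proof.
move=> h _; exists \top => //.
by case: (svalP h) => _ h1 _ _ _; rewrite /basic_set /= h1.
Qed.

Lemma basic_setI a b : basic_set (a `&` b) = (basic_set a `&` basic_set b)%classic.
Proof.
rewrite predeqE => h; case: (svalP h) => _ _ hI _ _; rewrite /basic_set /= hI.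
by split=> [/andP|[-> ->]].
Qed.

Lemma basic_setU a b : basic_set (a `|` b) = (basic_set a `|` basic_set b)%classic.
Proof.
rewrite predeqE => h; case: (svalP h) => _ _ _ hU _; rewrite /basic_set /= hU.
by split=> [/orP|/orP].
Qed.

Lemma basic_set0 : basic_set \bot = set0.
Proof.
by rewrite predeqE => h; case: (svalP h) => h0 _ _ _ _; rewrite /basic_set /= h0.
Qed.

Lemma basic_setC a : basic_set (~` a) = (~` basic_set a)%classic.
Proof.
rewrite predeqE => h; case: (svalP h) => _ _ _ _ hC; rewrite /basic_set /= hC.
by split=> /negP.
Qed.

Lemma spectrum_openI : setI_closed spectrum_open.
Proof.
move=> O O' OO OO' h [/OO[a ah aO] /OO'[b bh bO]]; exists (a `&` b).
  by rewrite basic_setI.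
by rewrite basic_setI; apply: setISS.
Qed.

Lemma spectrum_open_bigcup (I : Type) (f : I -> set spectrum) :
  (forall i, spectrum_open (f i)) -> spectrum_open (\bigcup_i f i).
Proof.
move=> fO h [i _ /fO[a ah af]]; exists a => // k /af; exact: bigcup_sup.
Qed.

HB.instance Definition _ := isOpenTopological.Build spectrum
  spectrum_openT spectrum_openI spectrum_open_bigcup.

Lemma basic_set_open a : open (basic_set a).
Proof. by move=> h ah; exists a. Qed.

Lemma basic_set_clopen a : clopen (basic_set a).
Proof.
split; first exact: basic_set_open.
by rewrite -[a]complK basic_setC; apply: open_closedC; apply: basic_set_open.
Qed.

(** An ultrafilter [F] clusters at the point that is true at [a] exactly when [basic_set a] is in
    [F]. This is a homomorphism because [F] is an ultrafilter, and each neighbourhood of it contains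
    a basic set that belongs to [F]. *)
Lemma spectrum_compact : compact [set: spectrum].
Proof.
rewrite compact_ultra => F FU _.
have FC a : F (~` basic_set a)%classic <-> ~ F (basic_set a).
  split=> [FCa Fa|]; last by case: (in_ultra_setVsetC (basic_set a) FU).
  by have [h []] := filter_ex (filterI Fa FCa).
have limP : boolean_hom (fun a => `[< F (basic_set a) >]).
  apply: boolean_hom_of_meet_compl => [a b|a] /=.
    apply/asboolP/andP; rewrite basic_setI.
      by move=> Fab; split; apply/asboolP; apply: filterS Fab => ? [].
    by move=> [/asboolP Fa /asboolP Fb]; apply: filterI.
  apply/asboolP/idP; rewrite basic_setC.
    by move=> /FC Fa; apply/asboolPn.
  by move=> /asboolPn/FC.
pose lim : spectrum := exist _ _ limP.
exists lim; split=> // O; rewrite /= nbhsE => -[O' [O'o O'l] O'O].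
by have [a /asboolP Fa aO'] := O'o _ O'l; apply: filterS Fa; apply: subset_trans O'O.
Qed.

Lemma spectrum_zero_dimensional : zero_dimensional spectrum.
Proof.
move=> h k hk; have [a hak] : exists a, sval h a <> sval k a.
  by apply/existsNP => hk'; move/eqP: hk; apply; apply: spectrum_ext.
(* The separating clopen must contain [h]: it is [basic_set a] or its complement, according to the
   value of [h] at [a]. *)
case ha : (sval h a) hak => hak.
  exists (basic_set a); split=> //; first exact: basic_set_clopen.
  by rewrite /basic_set /= => /esym.
exists (basic_set (~` a)); split; first exact: basic_set_clopen.
  by rewrite basic_setC => ha'; move: ha; rewrite [sval h a]ha'.
by rewrite basic_setC; apply; rewrite /basic_set /=; case: (sval k a) hak.
Qed.

Lemma spectrum_hausdorff : hausdorff_space spectrum.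
Proof.
rewrite open_hausdorff => h k /spectrum_zero_dimensional[U [[oU cU] Uh Uk]].
exists (U, ~` U)%classic; split=> //=; rewrite ?inE //; last by rewrite setICr.
exact: closed_openC.
Qed.

Definition spectrum_stone : stone_space :=
  StoneSpace spectrum_compact spectrum_hausdorff
    (zero_dimension_totally_disconnected spectrum_zero_dimensional).

(* Otherwise the sets [S `\` basic_set a] with [basic_set a `<=` S] generate a
   proper filter containing [S], and it has no cluster point in [S]. *)
Lemma clopen_basic_set (S : set spectrum) :
  clopen S -> exists a, S = basic_set a.
Proof.
move=> [So Sc].
pose F : set_system spectrum :=
  [set P | exists2 a, basic_set a `<=` S & S `\` basic_set a `<=` P].
have FF : Filter F.
  split=> [|P Q [a aS aP] [b bS bQ]|P Q PQ [a aS aP]].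
  - by exists \bot; rewrite ?basic_set0.
  - exists (a `|` b); rewrite basic_setU; first by rewrite subUset.
    by move=> h [Sh nab]; split; [apply: aP|apply: bQ];
      split=> // hab; apply: nab; [left|right].
  - by exists a => //; apply: subset_trans PQ.
have [[a aS]|F0] := pselect (F set0).
  by rewrite subset0 setD_eq0 => Sa; exists a; rewrite eqEsubset.
have PF : ProperFilter F by [].
have FS : F S by exists \bot; [rewrite basic_set0 | exact: subDsetl].
have [h [Sh clh]] := subclosed_compact Sc spectrum_compact (@subsetT _ S) PF FS.
have [b bh bS] := So h Sh.
have Fb : F (S `\` basic_set b) by exists b.
by have [k [[_]]] := clh _ _ Fb (open_nbhs_nbhs (conj (@basic_set_open b) bh)).
Qed.

Lemma basic_set_le a b : basic_set a `<=` basic_set b -> a <= b.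
Proof.
by move=> ab; apply: point_separation => h hh; apply: (ab (exist _ h hh)).
Qed.

Lemma basic_set_inj : injective basic_set.
Proof.
by move=> a b ab; apply/le_anti/andP; split; apply: basic_set_le; rewrite ab.
Qed.

End Points.

Section SpectrumMap.
Variables (d d' : Order.disp_t).
Variables (A : ctbDistrLatticeType d) (A' : ctbDistrLatticeType d').
Variables (f : A -> A') (f_hom : boolean_hom f).

Definition precomp (h : spectrum A') : spectrum A :=
  exist _ (sval h \o f) (boolean_hom_comp (svalP h) f_hom).

(** The preimage of [basic_set a] is [basic_set (f a)]. *)
Lemma precomp_continuous : continuous precomp.
Proof.
apply/continuousP => O Oo.
suff : spectrum_open (precomp @^-1` O) by [].
by move=> h /Oo[a ah aO]; exists (f a) => // k ka; apply: aO.
Qed.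

Definition spectrum_map : continuousType (spectrum A') (spectrum A) :=
  mkcts precomp_continuous.

End SpectrumMap.

End StoneDuality.

(** * Equality of arrows and functors, and strict pullbacks of categories *)

Section StrictPullbacks.

Definition arrow (C : category) := {xy : C * C & hom xy.1 xy.2}.

(* Equality of the packed arrows is equality of two arrows whose endpoints are
   only propositionally equal. *)
Definition Arr (C : category) (x y : C) (f : hom x y) : arrow C :=
  existT (fun xy : C * C => hom xy.1 xy.2) (x, y) f.

(** The second components agree up to transport along an equality of [(x, y)] with itself, which is
    trivial by proof irrelevance. *)
Lemma Arr_inj (C : category) (x y : C) (f g : hom x y) : Arr f = Arr g -> f = g.
Proof.
by move=> fg; have := projT2_eq fg; rewrite (Prop_irrelevance (projT1_eq fg) erefl).
Qed.

Lemma Arr_dom (C : category) (x y x' y' : C) (f : hom x y) (f' : hom x' y') :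
  Arr f = Arr f' -> x = x'.
Proof. exact: (congr1 (fun u : arrow C => (projT1 u).1)). Qed.

Lemma Arr_cod (C : category) (x y x' y' : C) (f : hom x y) (f' : hom x' y') :
  Arr f = Arr f' -> y = y'.
Proof. exact: (congr1 (fun u : arrow C => (projT1 u).2)). Qed.

Lemma Arr_comp (C : category) (x y z x' y' z' : C) (g : hom y z) (f : hom x y)
    (g' : hom y' z') (f' : hom x' y') :
  Arr g = Arr g' -> Arr f = Arr f' -> Arr (g \c f) = Arr (g' \c f').
Proof.
move=> gg ff; move: (Arr_dom ff) (Arr_dom gg) (Arr_cod gg) => ex ey ez.
by subst x' y' z'; rewrite (Arr_inj gg) (Arr_inj ff).
Qed.

Lemma Arr_fhom (C D : category) (F G : functor C D) (x y : C) (f : hom x y) :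
  F = G -> Arr (fhom F f) = Arr (fhom G f).
Proof. by move->. Qed.

Lemma functor_ext (C D : category) (F G : functor C D) :
  (forall x, F x = G x) ->
  (forall x y (f : hom x y), Arr (fhom F f) = Arr (fhom G f)) -> F = G.
Proof.
case: F G => [F0 F1 F1i F1c] [G0 G1 G1i G1c] /= /funext FG0; subst G0 => FG1.
have eFG : F1 = G1.
  do 3![apply: functional_extensionality_dep => ?]; apply: Arr_inj; exact: FG1.
by subst G1; congr Functor; apply: Prop_irrelevance.
Qed.

(** Choice selects the values of the mediating functor on objects and arrows. Uniqueness on arrows
    makes [p] and [q] jointly faithful, which yields the functor laws and, with uniqueness on
    objects, the uniqueness of the functor. *)
Lemma pullback_criterion (P A A' C : category) (p : functor P A)
    (q : functor P A') (F : functor A C) (U : functor A' C) :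
  functor_comp F p = functor_comp U q ->
  (forall a a', F a = U a' -> exists! x, p x = a /\ q x = a') ->
  (forall (x y : P) (f : hom (p x) (p y)) (g : hom (q x) (q y)),
    Arr (fhom F f) = Arr (fhom U g) ->
    exists! u : hom x y, fhom p u = f /\ fhom q u = g) ->
  is_pullback p q F U.
Proof.
move=> sq objP homP; split=> // D s t st.
have /choice[h0 h0P] d : exists x, p x = s d /\ q x = t d.
  have [x [xP _]] := objP (s d) (t d) (congr1 (fun G : functor _ _ => G d) st).
  by exists x.
have h1P d d' (k : hom d d') : exists u : hom (h0 d) (h0 d'),
    Arr (fhom p u) = Arr (fhom s k) /\ Arr (fhom q u) = Arr (fhom t k).
  have := Arr_fhom k st => /=.
  (* Once the two arrows are generalized, their endpoints can be rewritten to images under [p] and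
     [q], as [homP] requires. *)
  move: (fhom s k) (fhom t k); have [<- <-] := h0P d; have [<- <-] := h0P d'.
  by move=> f g fg; have [u [[<- <-] _]] := homP _ _ f g fg; exists u.
have arrow_inj (x y x' y' : P) (u : hom x y) (u' : hom x' y') :
    x = x' -> y = y' -> Arr (fhom p u) = Arr (fhom p u') ->
    Arr (fhom q u) = Arr (fhom q u') -> Arr u = Arr u'.
  move=> ex ey; subst x' y' => /Arr_inj pu /Arr_inj qu.
  have [v [_ vU]] := homP _ _ (fhom p u) (fhom q u) (Arr_fhom u sq).
  by rewrite -(vU u) // (vU u').
pose h1 d d' (k : hom d d') := sval (cid (h1P d d' k)).
have h1E d d' (k : hom d d') : Arr (fhom p (h1 _ _ k)) = Arr (fhom s k) /\
    Arr (fhom q (h1 _ _ k)) = Arr (fhom t k) by exact: svalP (cid (h1P d d' k)).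
have Arr_id (X : category) (a b : X) : a = b -> Arr (idc a) = Arr (idc b).
  by move=> ->.
have hid d : h1 _ _ (idc d) = idc (h0 d).
  have [ps qt] := h0P d; have [pk qk] := h1E _ _ (idc d).
  by apply/Arr_inj/arrow_inj; rewrite ?(pk, qk) // !fhom1; apply: Arr_id.
have hM d1 d2 d3 (g : hom d2 d3) (f : hom d1 d2) :
    h1 _ _ (g \c f) = h1 _ _ g \c h1 _ _ f.
  have [pf qf] := h1E _ _ f; have [pg qg] := h1E _ _ g.
  have [pgf qgf] := h1E _ _ (g \c f).
  apply/Arr_inj/arrow_inj; rewrite ?(pgf, qgf) // !fhomM; apply/esym.
    exact: Arr_comp.
  exact: Arr_comp.
exists (Functor hid hM); split.
  by split; apply: functor_ext => [d|d d' k] /=; case: (h0P d) => //; case: (h1E _ _ k).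
move=> h' [h's h't].
have pd d : p (h' d) = s d := congr1 (fun G : functor _ _ => G d) h's.
have qd d : q (h' d) = t d := congr1 (fun G : functor _ _ => G d) h't.
have h0E d : h0 d = h' d.
  have [x [_ xU]] := objP (s d) (t d) (congr1 (fun G : functor _ _ => G d) st).
  by rewrite -(xU _ (h0P d)) (xU (h' d)).
apply: functor_ext => //= d d' k; have [pk qk] := h1E _ _ k.
apply: arrow_inj => //; rewrite ?(pk, qk).
  exact: esym (Arr_fhom k h's).
exact: esym (Arr_fhom k h't).
Qed.

End StrictPullbacks.

(** * Categories isomorphic to a poset *)

Section PosetIso.
Local Open Scope order_scope.
Import Order.Theory.
Variables (C : category) (d : Order.disp_t) (A : porderType d).
Variable (J : cat_iso C (poset_cat A)).

Lemma iso_from_to (x : C) : iso_from J (iso_to J x) = x.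
Proof. exact: (congr1 (fun G : functor C C => G x) (iso_toK J)). Qed.

Lemma iso_to_from (a : poset_cat A) : iso_to J (iso_from J a) = a.
Proof. exact: (congr1 (fun G : functor _ (poset_cat A) => G a) (iso_fromK J)). Qed.

(** An arrow of [poset_cat A] is a proof of an inequality, so each direction is the action on arrows
    of one of the two functors. *)
Lemma iso_to_le (x y : C) :
  (iso_to J x : A) <= iso_to J y <-> inhabited (hom x y).
Proof.
split=> [le_xy|[u]]; last exact: (fhom (iso_to J) u).
by constructor; rewrite -(iso_from_to x) -(iso_from_to y); apply: (fhom (iso_from J)).
Qed.

(** By [iso_toK] an arrow is recovered from its image in the poset, where parallel arrows are
    equal. *)
Lemma poset_iso_thin (x y : C) (u v : hom x y) : u = v.
Proof.
apply: Arr_inj; rewrite -[Arr u](Arr_fhom u (iso_toK J)).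
rewrite -[Arr v](Arr_fhom v (iso_toK J)) /=.
suff -> : fhom (iso_to J) u = fhom (iso_to J) v by [].
exact: (@Prop_irrelevance ((iso_to J x : A) <= iso_to J y)).
Qed.

End PosetIso.

(** * The functors to [Stone] and [Clopen], and the pullback square *)

Section Classifying.
Local Open Scope order_scope.
Import Order.Theory.
Variables (E B : category) (p : functor E B) (fib_p : fibration p).
Variables (d : Order.disp_t) (A : B -> ctbDistrLatticeType d).
Variable J : forall b : B, cat_iso (fiber p b) (poset_cat (A b)).

Definition pull (a b : B) (f : hom a b) (x : A b) : A a :=
  iso_to (J a) (reindexing fib_p f (iso_from (J b) x)).

Hypothesis pull_boolean : forall (a b : B) (f : hom a b), boolean_hom (pull f).

(** Arrows over [f] into [y] factor through the cartesian lifting of [f] at [y] by an arrow of the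
    fiber over [a], that is, by an inequality. *)
Lemma le_pull (a b : B) (f : hom a b) (x : fiber p a) (y : fiber p b) :
  (iso_to (J a) x : A a) <= pull f (iso_to (J b) y) <->
  exists u : hom (sval x) (sval y), lies_over p u f.
Proof.
rewrite /pull iso_from_to; split=> [/(iso_to_le (J a))[h]|[u uf]].
  exists (reindex_lift fib_p f y \c sval h).
  by have := lies_over_comp (reindex_lift_over fib_p f y) (svalP h); rewrite comp_id.
have [|h [[hO _] _]] := cartesian_factor (w := idc a) (v := u)
  (reindex_lift_over fib_p f y) (@reindex_lift_cartesian _ _ _ fib_p _ _ f y).
  by rewrite comp_id.
by apply/(iso_to_le (J a)); constructor; exists h.
Qed.

Lemma lies_over_unique (a b : B) (f : hom a b) (x : fiber p a) (y : fiber p b)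
    (u v : hom (sval x) (sval y)) :
  lies_over p u f -> lies_over p v f -> u = v.
Proof.
have factor (w : hom (sval x) (sval y)) : lies_over p w f ->
    exists h : hom x (reindexing fib_p f y), reindex_lift fib_p f y \c sval h = w.
  move=> wf; have [|h [[hO hw] _]] := cartesian_factor (w := idc a) (v := w)
    (reindex_lift_over fib_p f y) (@reindex_lift_cartesian _ _ _ fib_p _ _ f y).
    by rewrite comp_id.
  by exists (exist _ h hO).
by move=> /factor[h <-] /factor[k <-]; rewrite (poset_iso_thin (J a) h k).
Qed.

(** The chosen liftings need not be split. By [le_pull] both sides have the same lower bounds, so
    antisymmetry gives a strict equality. *)
Lemma pull_id (b : B) (x : A b) : pull (idc b) x = x.
Proof.
suff le_id z : (z <= pull (idc b) x) = (z <= x).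
  by apply/le_anti/andP; split; [rewrite -le_id | rewrite le_id].
rewrite -(iso_to_from (J b) x) -(iso_to_from (J b) z); apply/idP/idP.
  by move=> /le_pull[u uO]; apply/(iso_to_le (J b)); constructor; exists u.
by move=> /(iso_to_le (J b))[u]; apply/le_pull; exists (sval u); apply: svalP u.
Qed.

(** Again lower bounds are compared: arrows over [g \c f] correspond to arrows over [f] into the
    source of the lifting of [g]. *)
Lemma pull_comp (a b c : B) (g : hom b c) (f : hom a b) (x : A c) :
  pull (g \c f) x = pull f (pull g x).
Proof.
suff le_comp z : (z <= pull (g \c f) x) = (z <= pull f (pull g x)).
  by apply/le_anti/andP; split; [rewrite -le_comp | rewrite le_comp].
rewrite -(iso_to_from (J a) z) -(iso_to_from (J c) x).
set x' := iso_from (J c) x.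
have -> : pull g (iso_to (J c) x') = iso_to (J b) (reindexing fib_p g x').
  by rewrite /pull iso_from_to.
have lift_over := reindex_lift_over fib_p g x'.
have lift_cart := @reindex_lift_cartesian _ _ _ fib_p _ _ g x'.
apply/idP/idP => /le_pull[u uO]; apply/le_pull.
  by have [h [[hO _] _]] := cartesian_factor lift_over lift_cart uO; exists h.
by eexists; apply: lies_over_comp lift_over uO.
Qed.

Definition Phi_obj (b : B) : Stone := spectrum_stone (A b).

Definition Phi_hom (a b : B) (f : hom a b) : hom (Phi_obj a) (Phi_obj b) :=
  spectrum_map (pull_boolean f).

Lemma Phi_hom1 (b : B) : Phi_hom (idc b) = idc (Phi_obj b).
Proof.
apply/continuousEP => h; apply: spectrum_ext => x /=.
by rewrite pull_id.
Qed.

Lemma Phi_homM (a b c : B) (g : hom b c) (f : hom a b) :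
  Phi_hom (g \c f) = Phi_hom g \c Phi_hom f.
Proof.
apply/continuousEP => h; apply: spectrum_ext => x /=.
by rewrite pull_comp.
Qed.

Definition Phi : functor B Stone := Functor Phi_hom1 Phi_homM.

Definition code (x : E) : A (p x) := iso_to (J (p x)) (exist _ x erefl).

Lemma code_le (x y : E) (f : hom (p x) (p y)) :
  code x <= pull f (code y) <-> exists u : hom x y, fhom p u = f.
Proof.
rewrite le_pull; split=> -[u uf]; exists u; first exact: lies_overE.
by rewrite -uf.
Qed.

Definition Psi_obj (x : E) : Clopen :=
  @ClopenPair (Phi (p x)) (basic_set (code x)) (basic_set_clopen (code x)).

Lemma Psi_hom_subproof (x y : E) (u : hom x y) :
  (fhom Phi (fhom p u) : continuousType _ _) @` basic_set (code x)
    `<=` basic_set (code y).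
Proof.
move=> _ [h hx <-]; rewrite /basic_set /=.
apply: boolean_hom_le hx; first exact: svalP h.
by apply/code_le; exists u.
Qed.

Definition Psi_hom (x y : E) (u : hom x y) : hom (Psi_obj x) (Psi_obj y) :=
  exist _ (fhom Phi (fhom p u)) (@Psi_hom_subproof x y u).

Lemma Psi_hom1 (x : E) : Psi_hom (idc x) = idc (Psi_obj x).
Proof. by apply: eq_exist; rewrite !fhom1. Qed.

Lemma Psi_homM (x y z : E) (v : hom y z) (u : hom x y) :
  Psi_hom (v \c u) = Psi_hom v \c Psi_hom u.
Proof. by apply: eq_exist; rewrite !fhomM. Qed.

Definition Psi : functor E Clopen := Functor Psi_hom1 Psi_homM.

(** Needed for objects whose image under [p] is only propositionally [b], such as those produced by
    [iso_from (J b)]. *)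
Lemma Psi_over (b : B) (x : fiber p b) :
  Psi (sval x) = @ClopenPair (Phi b) _ (basic_set_clopen (iso_to (J b) x : A b)).
Proof. by case: x => x e; subst b. Qed.

Lemma clopen_pair_inj (X : stone_space) (S T : set X)
    (hS : clopen S) (hT : clopen T) :
  ClopenPair hS = ClopenPair hT -> S = T.
Proof.
move=> e; pose F (Y : clopen_pair) :=
  existT (fun X : stone_space => set X) Y (clopen_set Y).
have Fe := congr1 F e; have := projT2_eq Fe.
by rewrite (Prop_irrelevance (projT1_eq Fe) erefl).
Qed.

Lemma classifying_pullback : is_pullback p Psi Phi Clopen_forget.
Proof.
apply: pullback_criterion => [|b [X S hS] bX|x y f g /Arr_inj fg].
- exact: functor_ext.
(* The clopen [S] is the basic set of some [a], whose object in the fiber over [b] is the required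
   one; it is unique by injectivity of [basic_set]. *)
- rewrite /= in bX; subst X; have [a Sa] := clopen_basic_set hS; subst S.
  exists (sval (iso_from (J b) a)); split.
    split; first exact: svalP (iso_from (J b) a).
    rewrite Psi_over; move: (basic_set_clopen _); rewrite iso_to_from => h.
    by congr ClopenPair; apply: Prop_irrelevance.
  move=> x [xb]; rewrite (Psi_over (exist _ x xb)) => /clopen_pair_inj/basic_set_inj <-.
  by rewrite iso_from_to.
- have : code x <= pull f (code y).
    apply: point_separation => h hh hx.
    have := svalP g; rewrite -[sval g]/(fhom Clopen_forget g) -fg.
    move=> /(_ (Phi_hom f (exist _ h hh))).
    by apply; exists (exist _ h hh).
  move=> /code_le[u uf]; exists u; split.
    by split=> //; apply: clopen_hom_inj => h; rewrite /= uf;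
      exact: (congr1 (fun k : continuousType (Phi (p x)) (Phi (p y)) => k h) fg).
  move=> v [vf _]; apply: (@lies_over_unique _ _ f (exist _ x erefl) (exist _ y erefl)) => /=.
    by rewrite -uf.
  by rewrite -vf.
Qed.

End Classifying.

Theorem theorem5p2 (E B : category) (p : functor E B) (fib_p : fibration p)
    (d : Order.disp_t) (A : B -> ctbDistrLatticeType d)
    (J : forall b : B, cat_iso (fiber p b) (poset_cat (A b)))
    (reindex_boolean : forall (a b : B) (f : hom a b),
      boolean_hom (fun x : A b =>
        iso_to (J a) (reindexing fib_p f (iso_from (J b) x)) : A a)) :
  exists (Phi : functor B Stone) (Psi : functor E Clopen),
    is_pullback p Psi Phi Clopen_forget.
Proof.
exists (Phi reindex_boolean), (Psi reindex_boolean).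
exact: classifying_pullback.
Qed.
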